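(* Let $f=\frac1n\sum_{i=1}^n f_i:\mathbb{R}^d\to\mathbb{R}$ where each $f_i$ is (possibly nonconvex and) $L$-smooth, and let $x^*$ be an optimal solution (global minimizer) of $\min_{x\in\mathbb{R}^d} f(x)$. Let $\eta = 1/(3Ln^{2/3})$ and $\beta = L/n^{1/3}$. Then $\gamma_n \ge \frac{1}{12Ln^{2/3}}$, and the output $x_a$ of the algorithm SAGA$(x^0,T,\eta)$ satisfies $$\mathbb{E}[\|\nabla f(x_a)\|^2] \le \frac{12Ln^{2/3}\,[f(x^{0}) - f(x^* )]}{T}.$$
   Context: A differentiable function $h$ is $L$-smooth ($L>0$) if $\|\nabla h(x)-\nabla h(y)\|\le L\|x-y\|$ for all $x,y\in\mathbb{R}^d$. Write $[n]=\{1,\dots,n\}$. Algorithm SAGA$(x^0,T,\eta)$, with $x^0\in\mathbb{R}^d$, an integer $T\ge 1$ and step size $\eta>0$: set $\alpha_i^0=x^0$ for all $i\in[n]$ and $g^0=\frac1n\sum_{i=1}^n\nabla f_i(\alpha_i^0)$. For $t=0,\dots,T-1$: pick $i_t,j_t$ uniformly at random from $[n]$ (independently of each other and of the past); set $v^t=\nabla f_{i_t}(x^t)-\nabla f_{i_t}(\alpha_{i_t}^t)+g^t$; set $x^{t+1}=x^t-\eta v^t$; set $\alpha_{j_t}^{t+1}=x^t$ and $\alpha_j^{t+1}=\alpha_j^t$ for $j\ne j_t$; set $g^{t+1}=g^t-\frac1n(\nabla f_{j_t}(\alpha_{j_t}^t)-\nabla f_{j_t}(\alpha_{j_t}^{t+1}))$.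 Output $x_a$ chosen uniformly at random from $\{x^t\}_{t=0}^{T-1}$. Expectations are over all the randomness. The quantity $\gamma_n$: define $c_T=0$ and, for $0\le t\le T-1$, $c_t=c_{t+1}(1-\frac1n+\eta\beta+2\eta^2L^2)+\eta^2L^3$; set $\Gamma_t=\eta-\frac{c_{t+1}\eta}{\beta}-\eta^2L-2c_{t+1}\eta^2$ and $\gamma_n=\min_{0\le t\le T-1}\Gamma_t$. *)

(* Defs.v *)
From mathcomp Require Import all_boot all_order all_algebra.
From mathcomp Require Import all_classical all_reals all_analysis.

Set Implicit Arguments.
Unset Strict Implicit.
Unset Printing Implicit Defensive.

Import Order.TTheory GRing.Theory Num.Theory.
Import numFieldNormedType.Exports.

Local Open Scope classical_set_scope.
Local Open Scope ring_scope.

Section Calculus.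
Variables (R : realType) (d : nat).
Implicit Types (h : 'rV[R]_d -> R) (x : 'rV[R]_d).

(* The norm `|x| on 'rV[R]_d is the sup norm; this is the Euclidean one. *)
Definition norm2 x : R := Num.sqrt (\sum_(k < d) x ord0 k ^+ 2).

Definition gradient h x : 'rV[R]_d := \row_(k < d) 'D_(delta_mx ord0 k) h x.

Definition smooth (L : R) h : Prop :=
  (forall x, differentiable h x) /\
  (forall x y, norm2 (gradient h x - gradient h y) <= L * norm2 (x - y)).

End Calculus.

Section Saga.
Variables (R : realType) (d n : nat).
Variable f : 'I_n -> 'rV[R]_d -> R.

Definition average : 'rV[R]_d -> R := fun x => n%:R^-1 * \sum_(i < n) f i x.

(* saga_x = x^t, saga_alpha = (alpha_i^t)_i, saga_g = g^t *)
Record saga_state := SagaState {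
  saga_x : 'rV[R]_d;
  saga_alpha : 'I_n -> 'rV[R]_d;
  saga_g : 'rV[R]_d }.

Definition saga_init (x0 : 'rV[R]_d) : saga_state :=
  {| saga_x := x0;
     saga_alpha := fun=> x0;
     saga_g := n%:R^-1 *: \sum_(i < n) gradient (f i) x0 |}.

Definition saga_step (eta : R) (i j : 'I_n) (s : saga_state) : saga_state :=
  let: SagaState x alpha g := s in
  let v := gradient (f i) x - gradient (f i) (alpha i) + g in
  let alpha' := fun k => if k == j then x else alpha k in
  {| saga_x := x - eta *: v;
     saga_alpha := alpha';
     saga_g := g - n%:R^-1 *: (gradient (f j) (alpha j)
                               - gradient (f j) (alpha' j)) |}.

Fixpoint saga (eta : R) (x0 : 'rV[R]_d) (i j : nat -> 'I_n) (t : nat) :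
    saga_state :=
  if t is t'.+1 then saga_step eta (i t') (j t') (saga eta x0 i j t')
  else saga_init x0.

End Saga.

Section Constants.
Variables (R : realType) (n T : nat) (L eta beta : R).

(* Backward recursion: c_T = 0, and c_t is obtained from it by T - t steps. *)
Definition saga_c (t : nat) : R :=
  iter (T - t)
    (fun c => c * (1 - n%:R^-1 + eta * beta + 2 * eta ^+ 2 * L ^+ 2)
              + eta ^+ 2 * L ^+ 3) 0.

Definition saga_Gamma (t : nat) : R :=
  eta - saga_c t.+1 * eta / beta - eta ^+ 2 * L - 2 * saga_c t.+1 * eta ^+ 2.

(* For 0 < T the default value Gamma_0 is itself one of the terms. *)
Definition saga_gamma : R :=
  \big[Num.min/saga_Gamma 0]_(t < T) saga_Gamma t.

End Constants.

Section Sampling.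
Variables (R : realType) (disp : measure_display) (Omega : measurableType disp).
Variable P : probability Omega R.

Definition uniform_rv (K : finType) (X : Omega -> K) : Prop :=
  forall k : K, measurable (X @^-1` [set k]) /\
                P (X @^-1` [set k]) = (#|K|%:R^-1)%:E.

Definition events_of (K : Type) (X : Omega -> K) : set (set Omega) :=
  [set X @^-1` B | B in [set: set K]].

Definition mutually_independent (I : finType) (F : I -> set (set Omega)) : Prop :=
  forall (J : {set I}) (E : I -> set Omega),
    (forall k, k \in J -> F k (E k)) ->
    P (\bigcap_(k in [set` J]) E k) = (\prod_(k in J) P (E k))%E.

Definition saga_sampling (n T : nat) (i j : nat -> Omega -> 'I_n)
    (a : Omega -> 'I_T) : Prop :=
  [/\ forall t, (t < T)%N -> uniform_rv (i t),
      forall t, (t < T)%N -> uniform_rv (j t),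
      uniform_rv a
    & mutually_independent (fun k : 'I_T + 'I_T + unit =>
        match k with
        | inl (inl t) => events_of (i t)
        | inl (inr t) => events_of (j t)
        | inr _ => events_of a
        end)].

End Sampling.

(* Main.v *)
Require Import Defs.
From mathcomp Require Import all_boot all_order all_algebra.
From mathcomp Require Import all_classical all_reals all_analysis.
From mathcomp Require Import ring lra measurable_realfun.

Set Implicit Arguments.
Unset Strict Implicit.
Unset Printing Implicit Defensive.

Import Order.TTheory GRing.Theory Num.Theory.
Import numFieldNormedType.Exports.

Local Open Scope classical_set_scope.
Local Open Scope ring_scope.

(* The potential [f(x^t) + c_t * (1/n) sum_k |x^t - alpha_k^t|^2] decreases in conditional
   expectation by at least [Gamma_t |grad f(x^t)|^2]: combine the descent inequality of an
   L-smooth function, the fact that [v^t] is an unbiased estimate of [grad f(x^t)] whose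
   variance is at most [L^2] times the mean squared distance to the anchors, and Young's
   inequality with weight [beta] for the cross term [<grad f(x^t), x^t - alpha_k^t>].
   Summing over [t] bounds [sum_t Gamma_t E|grad f(x^t)|^2] by [f(x^0) - f(x^* )].
   With [p = n^(-1/3)] the step sizes read [eta = p^2/(3L)], [beta = L p], and the backward
   recursion keeps [c_t] in [[0, L p / 4]], whence [Gamma_t >= eta / 4].
   The run depends only on finitely many draws, which are jointly uniform, so the
   expectation is a plain average over [{ffun 'I_T -> 'I_n * 'I_n} * 'I_T], and conditioning
   on the past is averaging over the value of one coordinate. *)

(** * Euclidean inner product and Young's inequality *)

Section InnerProduct.
Variables (R : realType) (d : nat).
Implicit Types (u v w : 'rV[R]_d).

Definition dot u v : R := \sum_(k < d) u ord0 k * v ord0 k.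

Lemma dotC u v : dot u v = dot v u.
Proof. by apply: eq_bigr => k _; rewrite mulrC. Qed.

Lemma dotDl u v w : dot (u + v) w = dot u w + dot v w.
Proof. by rewrite -big_split; apply: eq_bigr => k _; rewrite mxE mulrDl. Qed.

Lemma dotZl c u v : dot (c *: u) v = c * dot u v.
Proof. by rewrite mulr_sumr; apply: eq_bigr => k _; rewrite mxE mulrA. Qed.

Lemma dotDr u v w : dot u (v + w) = dot u v + dot u w.
Proof. by rewrite dotC dotDl ![dot _ u]dotC. Qed.

Lemma dotZr c u v : dot u (c *: v) = c * dot u v.
Proof. by rewrite dotC dotZl dotC. Qed.

Lemma dotNl u v : dot (- u) v = - dot u v.
Proof. by rewrite -scaleN1r dotZl mulN1r. Qed.

Lemma dotNr u v : dot u (- v) = - dot u v.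
Proof. by rewrite dotC dotNl dotC. Qed.

Definition dotE := (dotDl, dotDr, dotNl, dotNr, dotZl, dotZr).

Lemma dot_suml (I : finType) (F : I -> 'rV[R]_d) v :
  dot (\sum_i F i) v = \sum_i dot (F i) v.
Proof.
rewrite /dot exchange_big; apply: eq_bigr => k _.
by rewrite summxE mulr_suml.
Qed.

Lemma dot_ge0 u : 0 <= dot u u.
Proof. by apply: sumr_ge0 => k _; rewrite -expr2 sqr_ge0. Qed.

Lemma norm2_sqr u : norm2 u ^+ 2 = dot u u.
Proof.
rewrite sqr_sqrtr; first by apply: eq_bigr => k _; rewrite expr2.
by apply: sumr_ge0 => k _; rewrite sqr_ge0.
Qed.

Lemma dot_young r u v : 0 < r -> 2 * dot u v <= r * dot u u + dot v v / r.
Proof.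
move=> r0; have := dot_ge0 (r *: u - v).
rewrite !dotE [dot v u]dotC => h.
rewrite -(ler_pM2l r0) mulrDr [r * (_ / r)]mulrC divfK ?gt_eqF//.
lra.
Qed.

End InnerProduct.

(** * Directional derivatives and the descent inequality of smooth functions *)

Section Descent.
Variables (R : realType) (d : nat).
Implicit Types (h : 'rV[R]_d -> R) (x y w : 'rV[R]_d).

Lemma derive_gradient h x w :
  differentiable h x -> 'D_w h x = dot (gradient h x) w.
Proof.
move=> dh; rewrite deriveE // [in LHS](row_sum_delta w) linear_sum.
by apply: eq_bigr => k _; rewrite linearZ mxE deriveE // mulrC.
Qed.

Lemma is_derive_line h x w (s : R) : differentiable h (x + s *: w) ->
  is_derive s 1 (fun s => h (x + s *: w)) (dot (gradient h (x + s *: w)) w).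
Proof.
move=> dh.
(* The difference quotients along the line at [s] are those of [h] at [x + s *: w] in direction
   [w]. *)
have E : (fun k : R => k^-1 *: (((fun s => h (x + s *: w)) \o shift s) (k *: 1)
                                - h (x + s *: w)))
  = (fun k => k^-1 *: ((h \o shift (x + s *: w)) (k *: w) - h (x + s *: w))).
  apply/funext => k /=; congr (_ *: (h _ - _)).
  by rewrite [k%:A]mulr1 scalerDl addrCA.
split; first by rewrite /derivable E; exact: diff_derivable.
by rewrite -derive_gradient // /derive E.
Qed.

Lemma smooth_dot L h x y : 0 <= L -> smooth L h ->
  dot (gradient h x - gradient h y) (gradient h x - gradient h y)
    <= L ^+ 2 * dot (x - y) (x - y).
Proof.
move=> L0 [_ hL]; rewrite -!norm2_sqr -exprMn.
by rewrite ler_sqr ?nnegrE ?mulr_ge0 ?sqrtr_ge0.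
Qed.

(** The mean value theorem on [[0, 1]] for [phi - psi], that is, [h] along the segment minus the
    non-constant part of its quadratic bound: the derivative at the intermediate point is at most
    0. *)
Lemma smooth_descent L h x w : 0 < L -> smooth L h ->
  h (x + w) <= h x + dot (gradient h x) w + L / 2 * dot w w.
Proof.
move=> L0 hL; have [dh _] := hL.
pose phi (s : R) := h (x + s *: w).
pose psi (s : R) := s *: dot (gradient h x) w + s ^+ 2 *: (L / 2 * dot w w).
have D (s : R) : is_derive s 1 (phi - psi) (dot (gradient h (x + s *: w)) w
    - (dot (gradient h x) w + L * s * dot w w)).
  have ? := is_derive_line (dh (x + s *: w)).
  apply: is_derive_eq.
  by rewrite /GRing.scale/= !mulr1; lra.
have [|s /[!in_itv]/= /andP[s0 _]] := @MVT R (phi - psi) _ 0 1 ltr01 (fun s _ => D s).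
  by apply: derivable_within_continuous => s _; have [] := D s.
rewrite !fctE /phi /psi !scale0r !scale1r addr0 subr0 ?mulr1.
rewrite expr1n expr0n /= !scale0r !scale1r => E.
(* Young's inequality with weight [1 / (L s)] bounds both of its terms by [L s |w|^2]. *)
have Ls : 0 < L * s by rewrite mulr_gt0.
have Ls' : 0 < (L * s)^-1 by rewrite invr_gt0.
have := dot_young (gradient h (x + s *: w) - gradient h x) w Ls'.
have := smooth_dot (x + s *: w) x (ltW L0) hL.
rewrite addrAC subrr add0r invrK.
set a := gradient h _ - _; rewrite !dotE => lip young.
have : (L * s)^-1 * dot a a <= L * s * dot w w.
  by rewrite mulrC ler_pdivrMr // /a !dotE; lra.
move: young; rewrite /a !dotE.
lra.
Qed.

End Descent.

Lemma sumr_cst (R : realType) (n : nat) (y : R) : \sum_(i < n) y = n%:R * y.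
Proof. by rewrite sumr_const card_ord mulr_natl. Qed.

(** * One step of the algorithm: expected decrease of the potential *)

Section Step.
Variables (R : realType) (d n : nat) (L eta beta : R).
Variable f : 'I_n -> 'rV[R]_d -> R.
Hypotheses (n_gt0 : (0 < n)%N) (L_gt0 : 0 < L) (eta_gt0 : 0 < eta)
  (beta_gt0 : 0 < beta) (f_smooth : forall i, smooth L (f i)).

Lemma gradient_average x :
  gradient (average f) x = n%:R^-1 *: \sum_(i < n) gradient (f i) x.
Proof.
have D i : differentiable (f i) x by have [] := f_smooth i.
apply/rowP => k; rewrite !mxE summxE.
have -> : average f = n%:R^-1 \*: (\sum_(i < n) f i).
  by apply/funext => y /=; rewrite fct_sumE.
have Di i : derivable (f i) x (delta_mx ord0 k) by exact: diff_derivable.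
rewrite deriveZ; last exact: derivable_sum.
by rewrite derive_sum //; congr (_ * _); apply: eq_bigr => i _; rewrite mxE.
Qed.

Lemma average_descent x w :
  average f (x + w) <=
  average f x + dot (gradient (average f) x) w + L / 2 * dot w w.
Proof.
have n0 : 0 < n%:R :> R by rewrite ltr0n.
have E (y : R) : y = n%:R^-1 * \sum_(i < n) y.
  by rewrite sumr_cst mulrA mulVf ?gt_eqF // mul1r.
rewrite gradient_average dotZl dot_suml [L / 2 * _]E -!mulrDr -!big_split /=.
rewrite ler_pM2l ?invr_gt0 //; apply: ler_sum => i _; exact: smooth_descent.
Qed.

Definition sqdist_avg (s : saga_state R d n) : R :=
  n%:R^-1 * \sum_(k < n) dot (saga_x s - saga_alpha s k) (saga_x s - saga_alpha s k).

Definition lyapunov c s := average f (saga_x s) + c * sqdist_avg s.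

(** Invariant of every run; it makes the mean over [i] of the directions [v^t] equal to the gradient
    of [average f]. *)
Definition table_consistent (s : saga_state R d n) :=
  saga_g s = n%:R^-1 *: \sum_(k < n) gradient (f k) (saga_alpha s k).

Lemma table_consistent_init x0 : table_consistent (saga_init f x0).
Proof. by []. Qed.

Lemma table_consistent_step i j s :
  table_consistent s -> table_consistent (saga_step f eta i j s).
Proof.
case: s => x al g; rewrite /table_consistent /= => ->.
rewrite -scalerBr; congr (_ *: _).
rewrite (bigD1 j) //= [in RHS](bigD1 j) //= eqxx opprB [LHS]addrC [LHS]addrA subrK.
by congr (_ + _); apply: eq_bigr => k /negPf ->.
Qed.

Lemma table_consistent_saga x0 i j t : table_consistent (saga f eta x0 i j t).
Proof.
elim: t => [|t IH]; first exact: table_consistent_init.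
exact: table_consistent_step.
Qed.

(* [saga_x (saga_step f eta i j s)] does not depend on [j], hence the dummy [i i] below;
   [j] moves one anchor to the old iterate, all others stay. *)
Lemma sum_sqdist_step i s :
  let x' := saga_x (saga_step f eta i i s) in
  \sum_(j < n) n%:R * sqdist_avg (saga_step f eta i j s) =
  n%:R * dot (x' - saga_x s) (x' - saga_x s) +
  (n%:R - 1) * \sum_(k < n) dot (x' - saga_alpha s k) (x' - saga_alpha s k).
Proof.
case: s => x al g; rewrite /sqdist_avg /=; set x' := x - _.
under eq_bigr => j _ do rewrite mulrA mulfV ?pnatr_eq0 -?lt0n // mul1r.
rewrite exchange_big [(_ - 1) * _]mulr_sumr -(@sumr_cst R).
rewrite -big_split; apply: eq_bigr => k _ /=.
rewrite (bigD1 k) //= eqxx; congr (_ + _).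
rewrite (eq_bigr (fun=> dot (x' - al k) (x' - al k))); last first.
  by move=> j /negPf jk; rewrite eq_sym jk.
rewrite sumr_const mulrBl mul1r mulr_natl; apply/eqP; rewrite eq_sym subr_eq.
by rewrite -mulrSr (cardC1 k) card_ord prednK.
Qed.

(** With [c = c_{t+1}], the weight on the right is [c_t] and the coefficient of the squared gradient
    is [Gamma_t]. The sum over [j] is computed exactly by [sum_sqdist_step]; the sum over [i] is
    bounded through [descent], [dist] and [V_le]. *)
Lemma lyapunov_step c s : 0 <= c -> table_consistent s ->
  n%:R ^- 2 * \sum_(i < n) \sum_(j < n) lyapunov c (saga_step f eta i j s) <=
  lyapunov (c * (1 - n%:R^-1 + eta * beta + 2 * eta ^+ 2 * L ^+ 2)
            + eta ^+ 2 * L ^+ 3) s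
  - (eta - c * eta / beta - eta ^+ 2 * L - 2 * c * eta ^+ 2)
    * norm2 (gradient (average f) (saga_x s)) ^+ 2.
Proof.
move=> c0; case: s => x al g; rewrite {1}/table_consistent.
rewrite [saga_x _]/= [saga_g _]/= [saga_alpha _]/= norm2_sqr => gE.
pose G := gradient (average f) x; rewrite -/G.
have n0 : 0 < n%:R :> R by rewrite ltr0n.
have n1 : 1 <= n%:R :> R by rewrite ler1n.
set N : R := n%:R in n0 n1 *.
pose s := SagaState x al g; pose A := sqdist_avg s.
pose u i := gradient (f i) x - gradient (f i) (al i).
pose v i := u i + g.
pose V := \sum_i dot (v i) (v i).
have A0 : 0 <= A.
  by rewrite mulr_ge0 ?invr_ge0 // sumr_ge0 // => k _; exact: dot_ge0.
have AE : \sum_k dot (x - al k) (x - al k) = N * A.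
  by rewrite /A /sqdist_avg /= mulrA mulfV ?gt_eqF // mul1r.
have G0 : 0 <= dot G G := dot_ge0 G.
have sumu : \sum_i u i = N *: (G - g).
  rewrite gE /G gradient_average -scalerBr scalerA mulfV ?gt_eqF // scale1r.
  by rewrite sumrB.
have sumv : \sum_i v i = N *: G.
  rewrite big_split sumu sumr_const card_ord -scaler_nat -/N /= -scalerDr subrK.
  by [].
(* The variance of [v i] is at most the second moment of [u i]. *)
have V_le : V <= N * (dot G G + L ^+ 2 * A).
  have -> : V = \sum_i dot (u i) (u i) + N * (2 * dot (G - g) g + dot g g).
    rewrite /V (eq_bigr (fun i => dot (u i) (u i) + (2 * dot (u i) g + dot g g))).
      rewrite !big_split /= -mulr_sumr -dot_suml sumu dotZl sumr_cst -/N. ring.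
    by move=> i _; rewrite /v; move: (u i) => w; rewrite !dotE [dot g w]dotC; ring.
  have : \sum_i dot (u i) (u i) <= L ^+ 2 * (N * A).
    rewrite -AE mulr_sumr; apply: ler_sum => i _.
    by apply: smooth_dot => //; exact: ltW.
  have : N * (2 * dot (G - g) g + dot g g) <= N * dot G G.
    rewrite ler_pM2l //; have := dot_ge0 (G - g).
    by rewrite !dotE [dot g G]dotC; lra.
  by move=> h1 h2; rewrite mulrDr; lra.
have descent : \sum_i average f (x - eta *: v i) <=
    N * (average f x - eta * dot G G) + L / 2 * eta ^+ 2 * V.
  apply: (@le_trans _ _ (\sum_i (average f x + (- eta) * dot (v i) G
                                 + (L / 2 * eta ^+ 2) * dot (v i) (v i)))).
    apply: ler_sum => i _; apply: le_trans (average_descent _ _) _.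
    by rewrite -/G; move: (v i) => w; rewrite !dotE [dot G w]dotC; lra.
  rewrite !big_split /= sumr_cst -!mulr_sumr -dot_suml sumv dotZl -/N -/V; lra.
(* For each anchor, summing over [i] turns the cross term into [- 2 eta N <x - al k, G>], which
   Young's inequality with weight [beta] splits. *)
have dist : \sum_i \sum_k dot (x - eta *: v i - al k) (x - eta *: v i - al k) <=
    N * (N * (1 + eta * beta) * A + N * eta / beta * dot G G + eta ^+ 2 * V).
  rewrite exchange_big /=.
  apply: (@le_trans _ _ (\sum_k (N * (1 + eta * beta) * dot (x - al k) (x - al k)
                                 + (N * eta / beta * dot G G + eta ^+ 2 * V)))).
    apply: ler_sum => k _.
    rewrite (eq_bigr (fun i => dot (x - al k) (x - al k)
      + (- (2 * eta)) * dot (v i) (x - al k) + eta ^+ 2 * dot (v i) (v i))); last first.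
      move=> i _; rewrite [x - _ - _]addrAC; move: (x - al k) (v i) => w z.
      by rewrite !dotE [dot w z]dotC; ring.
    rewrite !big_split /= sumr_cst -!mulr_sumr -dot_suml sumv dotZl -/N -/V.
    move: (x - al k) => w.
    have := dot_young (- w) G beta_gt0.
    rewrite !dotE opprK [dot w G]dotC => /(ler_wpM2l (ltW (mulr_gt0 n0 eta_gt0))); lra.
  rewrite big_split /= -mulr_sumr AE sumr_cst -/N; lra.
have -> : \sum_(i < n) \sum_(j < n) lyapunov c (saga_step f eta i j s) =
   N * \sum_i average f (x - eta *: v i) +
   c / N * (N * eta ^+ 2 * V +
     (N - 1) * \sum_i \sum_k dot (x - eta *: v i - al k) (x - eta *: v i - al k)).
  rewrite mulrDr [c / N * (_ * V)]mulrA [c / N * (_ * \sum_(_ < _) _)]mulrA.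
  rewrite /V [_ * \sum_(i < n) average f _]mulr_sumr.
  rewrite ![c / N * _ * \sum_(i < n) _]mulr_sumr -!big_split /=; apply: eq_bigr => i _.
  rewrite big_split /= sumr_cst -/N -mulr_sumr; congr (_ + _).
  have := sum_sqdist_step i s; rewrite -/N -mulr_sumr /=.
  rewrite -/(u i) -/(v i).
  have -> : dot (x - eta *: v i - x) (x - eta *: v i - x) = eta ^+ 2 * dot (v i) (v i).
    by move: (v i) => w; rewrite [x - _ - x]addrAC subrr add0r !dotE; ring.
  rewrite -[c / N * _ * dot _ _]mulrA -[c / N * _ * \sum_(_ < _) _]mulrA -mulrDr.
  by rewrite -[N * _ * dot _ _]mulrA => <-; rewrite mulrA divfK ?gt_eqF.
have [W VE] : exists W, V = N * W by exists (N^-1 * V); rewrite mulrA mulfV ?gt_eqF // mul1r.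
move: descent dist V_le; rewrite VE ler_pM2l //.
set SF := \sum_i average f _; set SD := \sum_i \sum_(_ < _) _.
set GG := dot G G in G0 * => descent dist W_le.
pose r := N^-1.
have r0 : 0 <= r by rewrite invr_ge0 ltW.
(* [r = 1/n] is the chance that a given anchor is refreshed; the parts of [eta^2 W] coming from
   refreshed and kept anchors, with weights [r] and [1 - r], recombine. *)
apply: (@le_trans _ _ (average f x - eta * GG + L / 2 * eta ^+ 2 * W
  + c * (eta ^+ 2 * W + (1 - r) * ((1 + eta * beta) * A + eta / beta * GG)))).
  have -> : N ^- 2 * (N * SF + c / N * (N * eta ^+ 2 * (N * W) + (N - 1) * SD)) =
      r * SF + c * (r * eta ^+ 2 * W + (1 - r) * (r * (r * SD))).
    by rewrite /r; field; rewrite gt_eqF.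
  have e1 : r * SF <= average f x - eta * GG + L / 2 * eta ^+ 2 * W.
    by rewrite ler_pdivrMl //; lra.
  have e2 : r * (r * SD) <= (1 + eta * beta) * A + eta / beta * GG + eta ^+ 2 * W.
    by rewrite !ler_pdivrMl //; lra.
  have r1 : 0 <= c * (1 - r) by rewrite mulr_ge0 // subr_ge0 invf_le1.
  have := ler_wpM2l r1 e2; lra.
(* [W <= GG + L^2 A] is already known; the right side is doubled to reproduce the constants of the
   recursion for [c_t] and of [Gamma_t]. *)
have h1 : (L / 2 * eta ^+ 2 + c * eta ^+ 2) * W <=
    (L / 2 * eta ^+ 2 + c * eta ^+ 2) * (2 * GG + 2 * L ^+ 2 * A).
  have LA : 0 <= L ^+ 2 * A by rewrite mulr_ge0 // sqr_ge0.
  apply: ler_wpM2l; last lra.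
  by rewrite addr_ge0 // mulr_ge0 ?sqr_ge0 // divr_ge0 // ltW.
have [e0 b0] := (ltW eta_gt0, ltW beta_gt0).
(* The terms [- r eta beta] and [- r eta / beta] left by the factor [1 - r] only help, so they are
   dropped. *)
have h2 : 0 <= c * r * eta * beta * A.
  by do ![apply: mulr_ge0 => //].
have h3 : 0 <= c * r * (eta / beta) * GG.
  by apply: mulr_ge0 => //; apply: mulr_ge0; [exact: mulr_ge0 | exact: divr_ge0].
rewrite /lyapunov /= -/A -/r.
lra.
Qed.

End Step.

(** * Averaging over one coordinate of a finite function *)

Section Resampling.
Variables (R : realType) (I K : finType).

Definition update (w : {ffun I -> K}) t k := [ffun s => if s == t then k else w s].

(** Exchanging [k] with [w t] is an involution on the pairs [(w, k)]; after reindexing by it the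
    summand is [H w], whatever [k] is. *)
Lemma sum_update (H : {ffun I -> K} -> R) (t : I) :
  \sum_w \sum_k H (update w t k) = #|K|%:R * \sum_w H w.
Proof.
rewrite pair_big /=.
have phiK : involutive (fun p : {ffun I -> K} * K => (update p.1 t p.2, p.1 t)).
  move=> [w k] /=; rewrite ffunE eqxx; congr (_, _).
  by apply/ffunP => s; rewrite !ffunE; case: eqP => [->|].
rewrite (reindex_inj (inv_inj phiK)) /=.
rewrite (eq_bigr (fun p => H p.1)) => [|[w k] _ /=]; last first.
  congr H; apply/ffunP => s; rewrite !ffunE.
  by case: eqP => [->|].
rewrite -(pair_bigA _ (fun w _ => H w)) /= mulr_sumr; apply: eq_bigr => w _.
by rewrite sumr_const mulr_natl.
Qed.

End Resampling.

(** * Summing the decrease over all tables of draws and all times *)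

Section Average.
Variables (R : realType) (d n T : nat) (L eta beta : R).
Variable f : 'I_n -> 'rV[R]_d -> R.
Variable x0 : 'rV[R]_d.
Hypotheses (n_gt0 : (0 < n)%N) (T_gt0 : (0 < T)%N) (L_gt0 : 0 < L)
  (eta_gt0 : 0 < eta) (beta_gt0 : 0 < beta) (f_smooth : forall i, smooth L (f i)).

(** Allows a draw to be changed without affecting the states up to its time, and random sequences to
    be replaced by their first [T] values. *)
Lemma eq_saga (i i' j j' : nat -> 'I_n) t :
  (forall s, (s < t)%N -> i s = i' s /\ j s = j' s) ->
  saga f eta x0 i j t = saga f eta x0 i' j' t.
Proof.
elim: t => [//|t IH] ij /=.
have [-> ->] := ij t (ltnSn t).
by rewrite IH // => s st; apply: ij; exact: ltnW.
Qed.

Local Notation W := {ffun 'I_T -> 'I_n * 'I_n}.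
Implicit Type w : W.

(* The values at times [t >= T] are irrelevant. *)
Definition draws w (t : nat) : 'I_n * 'I_n :=
  oapp w (Ordinal n_gt0, Ordinal n_gt0) (insub t).

Definition saga_run w t :=
  saga f eta x0 (fun s => (draws w s).1) (fun s => (draws w s).2) t.

Lemma draws_ord w (t : 'I_T) : draws w t = w t.
Proof. by rewrite /draws valK. Qed.

Lemma saga_run_update w (t : 'I_T) k :
  saga_run (update w t k) t.+1 = saga_step f eta k.1 k.2 (saga_run w t).
Proof.
rewrite /saga_run /= draws_ord ffunE eqxx; congr (saga_step _ _ _ _ _).
apply: eq_saga => s st.
suff -> : draws (update w t k) s = draws w s by [].
have sT := ltn_trans st (ltn_ord t).
by rewrite -[s]/(val (Ordinal sT)) !draws_ord ffunE -val_eqE /= ltn_eqF.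
Qed.

Lemma saga_cS t : (t < T)%N -> saga_c n T L eta beta t =
  saga_c n T L eta beta t.+1 *
    (1 - n%:R^-1 + eta * beta + 2 * eta ^+ 2 * L ^+ 2) + eta ^+ 2 * L ^+ 3.
Proof. by move=> tT; rewrite /saga_c -subnSK. Qed.

Let c := saga_c n T L eta beta.
Let Gamma := saga_Gamma n T L eta beta.
Let grad_sq w t := norm2 (gradient (average f) (saga_x (saga_run w t))) ^+ 2.

Hypothesis c_ge0 : forall t, 0 <= c t.

(** Resampling the draw at [t] by [sum_update] replaces the next state by the mean over its [n^2]
    possible successors; [lyapunov_step] then applies for each [w]. *)
Lemma sum_lyapunov_step (t : 'I_T) :
  \sum_w lyapunov f (c t.+1) (saga_run w t.+1) + Gamma t * \sum_w grad_sq w t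
  <= \sum_w lyapunov f (c t) (saga_run w t).
Proof.
have n0 : 0 < n%:R :> R by rewrite ltr0n.
have E : \sum_w lyapunov f (c t.+1) (saga_run w t.+1) = \sum_w n%:R ^- 2 *
    \sum_(i < n) \sum_(j < n) lyapunov f (c t.+1) (saga_step f eta i j (saga_run w t)).
  have := sum_update (fun w => lyapunov f (c t.+1) (saga_run w t.+1)) t.
  under eq_bigr => w _ do under eq_bigr => k _ do rewrite saga_run_update.
  under eq_bigr => w _ do rewrite -(pair_bigA _ (fun i j => lyapunov f (c t.+1)
    (saga_step f eta i j (saga_run w t)))).
  rewrite -mulr_sumr card_prod card_ord natrM -expr2 => ->.
  by rewrite mulrA mulVf ?mul1r // expf_neq0 // gt_eqF.
rewrite E mulr_sumr -big_split /=; apply: ler_sum => w _.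
have := lyapunov_step n_gt0 L_gt0 eta_gt0 beta_gt0 f_smooth (c_ge0 t.+1)
  (table_consistent_saga eta f x0 _ _ t : table_consistent f (saga_run w t)).
rewrite -saga_cS // /grad_sq /Gamma /saga_Gamma -/c; lra.
Qed.

Lemma sum_lyapunov_le t : (t <= T)%N ->
  \sum_w lyapunov f (c t) (saga_run w t) + \sum_(s < t) Gamma s * \sum_w grad_sq w s
  <= \sum_(w : W) average f x0.
Proof.
elim: t => [_|t IH tT].
  (* All anchors start at [x0], so the distance term of the potential vanishes. *)
  rewrite big_ord0 addr0; apply: ler_sum => w _.
  rewrite /lyapunov /sqdist_avg /= big1 ?mulr0 ?addr0 // => k _.
  by rewrite subrr -(scale0r 0) dotZl mul0r.
rewrite big_ord_recr /=; have := IH (ltnW tT).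
have := sum_lyapunov_step (Ordinal tT); rewrite /=; lra.
Qed.

Lemma mean_grad_sq_le gamma fmin : 0 < gamma ->
  (forall t, (t < T)%N -> gamma <= Gamma t) -> (forall x, fmin <= average f x) ->
  (#|{: W * 'I_T}|%:R)^-1 *
    (\sum_(p : W * 'I_T) grad_sq p.1 p.2)
  <= (average f x0 - fmin) / (gamma * T%:R).
Proof.
move=> gamma0 gammaP fminP; have := sum_lyapunov_le (leqnn T).
set S := \sum_(p : _ * _) _.
have SE : S = \sum_(t < T) \sum_w grad_sq w t.
  by rewrite /S -(pair_bigA _ (fun w (t : 'I_T) => grad_sq w t)) exchange_big.
have h1 : gamma * S <= \sum_(s < T) Gamma s * \sum_w grad_sq w s.
  rewrite SE mulr_sumr; apply: ler_sum => t _; apply: ler_wpM2r; last exact: gammaP.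
  by apply: sumr_ge0 => w _; exact: sqr_ge0.
(* Since [c_T = 0], the final potential is [average f] at the last iterate. *)
have h2 : \sum_(w : W) fmin <= \sum_w lyapunov f (c T) (saga_run w T).
  by apply: ler_sum => w _; rewrite /lyapunov /c /saga_c subnn mul0r addr0.
set M : R := #|{: W}|%:R.
have cstE (y : R) : \sum_(w : W) y = M * y by rewrite sumr_const mulr_natl.
rewrite !cstE in h2 *; rewrite card_prod natrM -/M card_ord => h3.
have M0 : 0 < M by rewrite ltr0n; apply/card_gt0P;
  exists [ffun=> (Ordinal n_gt0, Ordinal n_gt0)].
have T0 : 0 < T%:R :> R by rewrite ltr0n.
rewrite ler_pdivrMl ?mulr_gt0 // mulrC.
rewrite [leRHS](_ : _ = M * (average f x0 - fmin) / gamma); last first.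
  by field; rewrite !gt_eqF.
rewrite ler_pdivlMr //; lra.
Qed.

End Average.

(** * Bounds on [c_t] and [Gamma_t] for the chosen step sizes *)

Section StepSize.
Variables (R : realType) (n T : nat) (L eta beta p : R).
Hypotheses (L_gt0 : 0 < L) (p_gt0 : 0 < p) (p_le1 : p <= 1)
  (nE : n%:R^-1 = p ^+ 3) (etaE : eta = p ^+ 2 / (3 * L)) (betaE : beta = L * p).

(** Induction along the backward recursion: one step sends [L p / 4] to
    [L p / 4 - L p^4 / 18 + L p^5 / 18], which is no larger because [p <= 1]. *)
Lemma saga_c_bound t : 0 <= saga_c n T L eta beta t <= L * p / 4.
Proof.
rewrite /saga_c; elim: (T - t)%N => [|m /andP[c0 cC]].
  by rewrite /= lexx divr_ge0 // mulr_ge0 // ltW.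
rewrite iterS; set c := iter m _ _ in c0 cC *; rewrite nE etaE betaE.
have L0 : L != 0 by rewrite gt_eqF.
have -> : c * (1 - p ^+ 3 + p ^+ 2 / (3 * L) * (L * p)
      + 2 * (p ^+ 2 / (3 * L)) ^+ 2 * L ^+ 2) + (p ^+ 2 / (3 * L)) ^+ 2 * L ^+ 3
    = c * (1 - 2 / 3 * p ^+ 3 + 2 / 9 * p ^+ 4) + p ^+ 4 * L / 9.
  by field.
have p3 : p ^+ 3 <= 1 by rewrite exprn_ile1 // ltW.
have p40 : 0 <= p ^+ 4 by rewrite exprn_ge0 // ltW.
have p43 : p ^+ 4 <= p ^+ 3 by rewrite [p ^+ 4]exprS ler_piMl // exprn_ge0 // ltW.
have q0 : 0 <= 1 - 2 / 3 * p ^+ 3 + 2 / 9 * p ^+ 4 by lra.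
apply/andP; split.
  by apply: addr_ge0; [exact: mulr_ge0 | rewrite divr_ge0 // mulr_ge0 // ltW].
have := ler_wpM2r q0 cC.
have : L * p * (p ^+ 4 ) <= L * p * p ^+ 3 by rewrite ler_wpM2l // mulr_ge0 // ltW.
rewrite -!mulrA -exprS; lra.
Qed.

Lemma saga_Gamma_bound t : p ^+ 2 / (12 * L) <= saga_Gamma n T L eta beta t.
Proof.
have /andP[c0 cC] := saga_c_bound t.+1; rewrite /saga_Gamma.
set c := saga_c _ _ _ _ _ _ in c0 cC *; rewrite etaE betaE.
have L0 : L != 0 by rewrite gt_eqF.
have p0 : p != 0 by rewrite gt_eqF.
(* Factor out the target. As [c <= L p / 4], the cofactor is at least [3 - 4/3 p^2 - 2/3 p^3], hence
   at least 1. *)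
have -> : p ^+ 2 / (3 * L) - c * (p ^+ 2 / (3 * L)) / (L * p)
      - (p ^+ 2 / (3 * L)) ^+ 2 * L - 2 * c * (p ^+ 2 / (3 * L)) ^+ 2 =
    p ^+ 2 / (12 * L) * (4 - 4 / 3 * p ^+ 2 - c * (4 / (L * p) + 8 / 3 * (p ^+ 2 / L))).
  by field; rewrite ?p0 ?L0.
have pL : 0 <= p ^+ 2 / (12 * L) by rewrite divr_ge0 ?sqr_ge0 // mulr_ge0 // ltW.
rewrite ler_peMr //.
have q0 : 0 <= 4 / (L * p) + 8 / 3 * (p ^+ 2 / L).
  by rewrite addr_ge0 ?divr_ge0 ?mulr_ge0 ?sqr_ge0 ?invr_ge0 // ltW.
have := ler_wpM2r q0 cC.
have -> : L * p / 4 * (4 / (L * p) + 8 / 3 * (p ^+ 2 / L)) = 1 + 2 / 3 * p ^+ 3.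
  by field; rewrite ?p0 ?L0.
have p3 : p ^+ 3 <= 1 by rewrite exprn_ile1 // ltW.
have p2 : p ^+ 2 <= 1 by rewrite exprn_ile1 // ltW.
lra.
Qed.

Lemma saga_gamma_bound : p ^+ 2 / (12 * L) <= saga_gamma n T L eta beta.
Proof.
(* The default value of the minimum is [Gamma_0], so the same bound covers it. *)
rewrite /saga_gamma; elim/big_ind: _ => [|x y|t _]; try exact: saga_Gamma_bound.
by rewrite le_min => -> ->.
Qed.

End StepSize.

(** * Expectations under a uniform law, and the joint law of the draws *)

Section Probability.
Variables (R : realType) (disp : measure_display) (Omega : measurableType disp).
Variable P : probability Omega R.

(** [H \o Z] is a finite sum of indicators of the events [Z = k] with weights [H k]; nonnegativity
    lets the integral pass through the sum. *)
Lemma expectation_uniform (K : finType) (Z : Omega -> K) (H : K -> R) :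
  (forall k, 0 <= H k) -> uniform_rv P Z ->
  ('E_P[H \o Z] = (#|K|%:R^-1 * \sum_k H k)%R%:E)%E.
Proof.
move=> H0 ZP; rewrite unlock.
have E o : (H (Z o))%:E = (\sum_k (H k * \1_(Z @^-1` [set k]) o)%:E)%E.
  rewrite sumEFin (bigD1 (Z o)) //= big1 => [|k kZ].
    by rewrite indicE mem_set // mulr1 addr0.
  by rewrite indicE memNset ?mulr0 // => /= ZE; rewrite ZE eqxx in kZ.
under eq_integral => o _ do rewrite /= E.
have mI k : measurable_fun setT (\1_(Z @^-1` [set k]) : Omega -> R).
  by apply: measurable_indic; case: (ZP k).
rewrite ge0_integral_sum //=; last 2 first.
- by move=> k; apply/measurable_EFinP; apply: measurable_funM.
- by move=> k o _; rewrite lee_fin mulr_ge0.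
rewrite mulr_sumr -sumEFin; apply: eq_bigr => k _.
have [mk Pk] := ZP k.
under eq_integral => o _ do rewrite EFinM.
rewrite ge0_integralZl ?lee_fin //; last exact/measurable_EFinP.
by rewrite integral_indic // setIT mulrC EFinM; congr (_ * _)%E; exact: Pk.
Qed.

(** Fixing all values is an intersection of [2T + 1] independent events, of probability [1/n] for
    the draws and [1/T] for the output index; the product is the inverse of the cardinal
    [(n * n)^T * T]. *)
Lemma saga_sampling_uniform n T (i j : nat -> Omega -> 'I_n) (a : Omega -> 'I_T) :
  saga_sampling P i j a ->
  uniform_rv P (fun o => ([ffun t : 'I_T => (i t o, j t o)], a o)).
Proof.
move=> [iU jU aU ind] [w k].
pose E (x : 'I_T + 'I_T + unit) : set Omega := match x with
  | inl (inl t) => i t @^-1` [set (w t).1]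
  | inl (inr t) => j t @^-1` [set (w t).2]
  | inr _ => a @^-1` [set k]
  end.
have -> : (fun o => ([ffun t : 'I_T => (i t o, j t o)], a o)) @^-1` [set (w, k)]
    = \bigcap_(x in [set` [set: 'I_T + 'I_T + unit]%SET]) E x.
  apply/seteqP; split => o /=.
    move=> [wE aE] [[t|t]|[]] _ //=; first by rewrite -wE ffunE.
    by rewrite -wE ffunE.
  move=> oE; congr (_, _); last by apply: (oE (inr tt)); rewrite /= inE.
  apply/ffunP => t; rewrite ffunE [RHS]surjective_pairing.
  by congr (_, _); [apply: (oE (inl (inl t))) | apply: (oE (inl (inr t)))]; rewrite /= inE.
have mE x : measurable (E x).
  case: x => [[t|t]|[]] /=; [case: (iU t (ltn_ord t) (w t).1)
    | case: (jU t (ltn_ord t) (w t).2) | case: (aU k)] => //.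
split.
  apply: fin_bigcap_measurable => // ; exact: finite_finset.
rewrite ind => [|[[t|t]|[]] _]; last 3 first.
- by exists [set (w t).1].
- by exists [set (w t).2].
- by exists [set k].
rewrite (eq_bigl xpredT) => [|x]; last by rewrite inE.
rewrite !big_sumType /= (eq_bigr (fun=> (n%:R^-1)%:E)); last first.
  by move=> t _; have [_ ->] := iU t (ltn_ord t) (w t).1; rewrite card_ord.
rewrite [X in (_ * X * _)%E](eq_bigr (fun=> (n%:R^-1)%:E)); last first.
  by move=> t _; have [_ ->] := jU t (ltn_ord t) (w t).2; rewrite card_ord.
rewrite [X in (_ * X)%E](eq_bigr (fun=> (T%:R^-1)%:E)); last first.
  by move=> _ _; have [_ ->] := aU k; rewrite card_ord.
rewrite !prodEFin !prodr_const card_unit card_ord -!EFinM; congr (_%:E).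
rewrite card_prod card_ffun card_prod !card_ord natrM natrX natrM expr1.
by rewrite !invfM exprVn exprMn invfM.
Qed.

End Probability.

(** * Transfer of the finite average to the random run *)

Theorem theorem3 (R : realType) (d n T : nat) (L eta beta : R)
    (f : 'I_n -> 'rV[R]_d -> R) (x0 xstar : 'rV[R]_d)
    (n_gt0 : (0 < n)%N) (T_gt0 : (0 < T)%N) (L_gt0 : 0 < L)
    (f_smooth : forall i, smooth L (f i))
    (xstar_min : forall x, average f xstar <= average f x)
    (eta_def : eta = 1 / (3 * L * n%:R `^ (2 / 3)))
    (beta_def : beta = L / n%:R `^ (1 / 3)) :
  saga_gamma n T L eta beta >= 1 / (12 * L * n%:R `^ (2 / 3)) /\
  forall (disp : measure_display) (Omega : measurableType disp)
    (P : probability Omega R) (i j : nat -> Omega -> 'I_n) (a : Omega -> 'I_T),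
    saga_sampling P i j a ->
    let x_a w := saga_x (saga f eta x0 (i ^~ w) (j ^~ w) (a w)) in
    ('E_P[fun w => (norm2 (gradient (average f) (x_a w)) ^+ 2)%R]
      <= (12 * L * n%:R `^ (2 / 3) * (average f x0 - average f xstar)
          / T%:R)%:E)%E.
Proof.
have n0 : 0 < n%:R :> R by rewrite ltr0n.
(* With [q = n^(1/3)] and [p = 1/q], all fractional powers of [n] become integer powers. *)
pose q : R := n%:R `^ (1 / 3).
have q0 : 0 < q by exact: powR_gt0.
have q1 : 1 <= q.
  rewrite /q -[leLHS](powRr0 n%:R); apply: ler_powR; first by rewrite ler1n.
  by rewrite divr_ge0.
have q2 : n%:R `^ (2 / 3) = q ^+ 2.
  by rewrite -powR_mulrn ?ltW // -powRrM; congr (_ `^ _); field.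
have q3 : n%:R = q ^+ 3.
  rewrite -powR_mulrn ?ltW // -powRrM (_ : 1 / 3 * 3%:R = 1); last by field.
  by rewrite powRr1 // ltW.
have qN : q != 0 by rewrite gt_eqF.
have LN : L != 0 by rewrite gt_eqF.
pose p := q^-1.
have p0 : 0 < p by rewrite invr_gt0.
have p1 : p <= 1 by rewrite invf_le1.
have nE : n%:R^-1 = p ^+ 3 by rewrite q3 exprVn.
have etaE : eta = p ^+ 2 / (3 * L) by rewrite eta_def q2 /p; field; rewrite ?qN ?LN.
have betaE : beta = L * p by rewrite beta_def.
have eta0 : 0 < eta by rewrite etaE divr_gt0 ?exprn_gt0 ?mulr_gt0.
have beta0 : 0 < beta by rewrite betaE mulr_gt0.
have gE : 1 / (12 * L * n%:R `^ (2 / 3)) = p ^+ 2 / (12 * L).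
  by rewrite q2 /p; field; rewrite ?qN ?LN.
split; first by rewrite gE; exact: saga_gamma_bound.
move=> disp Omega P i j a samp; cbv zeta.
pose W := {ffun 'I_T -> 'I_n * 'I_n}.
pose H (z : W * 'I_T) :=
  norm2 (gradient (average f) (saga_x (saga_run eta f x0 n_gt0 z.1 z.2))) ^+ 2.
(* The output index is below [T], so the output is a function of the tuple of the first [T] draws
   and that index. *)
have -> : (fun w => norm2 (gradient (average f)
      (saga_x (saga f eta x0 (i ^~ w) (j ^~ w) (a w)))) ^+ 2) =
    H \o (fun o => ([ffun t : 'I_T => (i t o, j t o)], a o)).
  apply/funext => o; rewrite /H /=; congr (norm2 (gradient _ (saga_x _)) ^+ 2).
  apply: eq_saga => s sa; have sT := ltn_trans sa (ltn_ord (a o)).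
  by rewrite -[s]/(val (Ordinal sT)) !draws_ord ffunE.
rewrite (expectation_uniform _ (saga_sampling_uniform samp)) => [|z]; last exact: sqr_ge0.
rewrite lee_fin.
apply: le_trans (mean_grad_sq_le x0 n_gt0 T_gt0 L_gt0 eta0 beta0 f_smooth _
  (gamma := p ^+ 2 / (12 * L)) _ _ xstar_min) _.
- by move=> t; have /andP[] := saga_c_bound T L_gt0 p0 p1 nE etaE betaE t.
- by rewrite divr_gt0 ?exprn_gt0 ?mulr_gt0.
- by move=> t _; exact: saga_Gamma_bound.
(* The two bounds are equal: [1 / gamma] is [12 L q^2]. *)
rewrite le_eqVlt; apply/orP; left; apply/eqP; rewrite q2 /p; field.
by rewrite qN LN pnatr_eq0 -lt0n T_gt0.
Qed.
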